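(* Let $q\geq 3$ and let $d$ be an even positive integer. Then $\chi(T_q,d)\leq (q-1)(d+1)$.
   Context: $T_q$ is the infinite $q$-regular tree, viewed as a metric space on its vertex set where each edge has length $1$ (so the distance is the combinatorial graph distance). For $d>0$, $\chi(T_q,d)$ is the minimal number of colors needed to color the vertices of $T_q$ so that any two vertices at distance exactly $d$ receive different colors. *)

(* Defs.v *)
From mathcomp Require Import all_boot.
Set Implicit Arguments.
Unset Strict Implicit.
Unset Printing Implicit Defensive.

Section InfiniteGraphs.

Variables (V : eqType) (e : rel V).

Definition simple_graph : Prop := symmetric e /\ irreflexive e.

Definition connected_graph : Prop :=
  inhabited V /\ forall x y : V, exists2 p : seq V, path e x p & last x p = y.

(* [ucycle e [:: x; y]] holds as soon as x and y are adjacent, so only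
   duplicate-free cyclic sequences with at least 3 vertices are graph cycles. *)
Definition acyclic_graph : Prop := forall c : seq V, ucycle e c -> size c < 3.

Definition regular_graph (q : nat) : Prop :=
  forall x : V, exists s : seq V, [/\ uniq s, size s = q & forall y, (y \in s) = e x y].

(* For q >= 2 such a graph is necessarily infinite, and it is unique up to
   isomorphism: it is T_q. *)
Definition regular_tree (q : nat) : Prop :=
  [/\ simple_graph, connected_graph, acyclic_graph & regular_graph q].

Definition walk (x y : V) (n : nat) : Prop :=
  exists p : seq V, [/\ path e x p, last x p = y & size p = n].

Definition at_distance (x y : V) (d : nat) : Prop :=
  walk x y d /\ forall n : nat, walk x y n -> d <= n.

Definition distance_colorable (d k : nat) : Prop :=
  exists c : V -> 'I_k, forall x y : V, at_distance x y d -> c x <> c y.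

(* Relational form of "chi(V, d) = k", so that no junk value is needed when
   finitely many colors do not suffice. *)
Definition is_distance_chromatic_number (d k : nat) : Prop :=
  distance_colorable d k /\ forall n : nat, distance_colorable d n -> k <= n.

End InfiniteGraphs.

(* Main.v *)
Require Import Defs.
From mathcomp Require Import all_boot.
From mathcomp Require Import zify boolp.

(** Put [b = q - 1], write [d = 2k] and root the tree at a vertex. A geodesic of
    length [d] climbs [i] steps to the last common ancestor of its endpoints and
    then descends [d - i] steps, so the depths of its endpoints have the same
    parity and differ by at most [d]. If they are equal, the endpoints have the
    same [k]-th ancestor but different [(k-1)]-st ancestors, hence the ranks of
    the latter among their siblings differ. So the pair (depth, rank) separates
    the endpoints. These ranks are less than [b], except that below the root,
    i.e. at depth [k], the rank [b] also occurs. The color is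
    [depth * b + rank] modulo [b * (d + 1)]: a vertex of depth [k] and rank [b]
    shares its color with vertices of depth [k + 1], whose parity is different,
    and with others whose depth differs from [k] by more than [d]. *)

Set Implicit Arguments.
Unset Strict Implicit.
Unset Printing Implicit Defensive.

Lemma ex_least (P : nat -> Prop) :
  (exists n, P n) -> exists2 n, P n & forall m, P m -> n <= m.
Proof.
move=> [n Pn].
have exP : exists n, (fun m => `[< P m >]) n by exists n; apply/asboolP.
have [m /asboolP Pm min_m] := ex_minnP exP.
by exists m => // j Pj; apply: min_m; apply/asboolP.
Qed.

(* For digits less than [b] parity would be irrelevant; it excludes the carry of
   a digit [b], which is allowed when [s <= k]. *)
Lemma parity_digit_mod_inj b k s t u v :
    0 < b -> 0 < k -> odd s = odd t -> s <= t + k.*2 -> t <= s + k.*2 ->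
    u + (k < s) <= b -> v + (k < t) <= b ->
  s * b + u = t * b + v %[mod b * k.*2.+1] -> s = t /\ u = v.
Proof.
move=> b_gt0 k_gt0.
wlog sum_leq : s t u v / s * b + u <= t * b + v.
  move=> ordered.
  have [|/ltnW] := leqP (s * b + u) (t * b + v); first exact: ordered.
  by move=> /ordered swapped *; case: swapped => // -> ->.
move=> parity _ t_leq u_leq v_leq /esym/eqP.
rewrite eqn_mod_dvd // => /dvdnP[[|c] diffE].
  have sum_eq : s * b + u = t * b + v by lia.
  have s_leq : s <= t.+1 by rewrite -(leq_pmul2r b_gt0); nia.
  have {}t_leq : t <= s.+1 by rewrite -(leq_pmul2r b_gt0); nia.
  have st : s = t by lia.
  by split=> //; move: sum_eq; rewrite st => /addnI.
have t_eq : t = s + k.*2 by nia.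
have v_eq : v = b by nia.
lia.
Qed.

Section Walks.

Variables (V : eqType) (e : rel V).

Lemma walk_rcons x y z n : walk e x y n -> e y z -> walk e x z n.+1.
Proof.
move=> [s [ps ls <-]] eyz; exists (rcons s z).
by rewrite rcons_path ps ls eyz last_rcons size_rcons.
Qed.

Lemma walk_cat x y z m n : walk e x y m -> walk e y z n -> walk e x z (m + n).
Proof.
move=> [s [ps ls <-]] [t [pt lt <-]]; exists (s ++ t).
by rewrite cat_path ps ls pt last_cat ls lt size_cat.
Qed.

Lemma walk_sym x y n : symmetric e -> walk e x y n -> walk e y x n.
Proof.
move=> symE [s [ps <- <-]]; exists (rev (belast x s)); split.
- by rewrite rev_path (eq_path (e' := e)) // => u v; rewrite symE.
- by case: s ps => //= a s _; rewrite rev_cons last_rcons.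
- by rewrite size_rev size_belast.
Qed.

Lemma walk_rcons_inv x z n : walk e x z n.+1 -> exists2 y, walk e x y n & e y z.
Proof.
move=> [s]; case: (lastP s) => [[] //|t y []].
rewrite rcons_path last_rcons size_rcons => /andP[pt et] <- [<-].
by exists (last x t) => //; exists t.
Qed.

Lemma connected_at_distance :
  connected_graph e -> forall x y, exists n, at_distance e x y n.
Proof.
move=> [_ conn] x y; have /ex_least [n wn min_n] : exists n, walk e x y n.
  by have [s ps ls] := conn x y; exists (size s), s.
by exists n.
Qed.

Lemma distance_chromatic_number_leq d n : distance_colorable e d n ->
  exists k, is_distance_chromatic_number e d k /\ k <= n.
Proof.
move=> col_n; have [k col_k min_k] := ex_least (ex_intro _ n col_n).
by exists k; split=> //; apply: min_k.
Qed.

End Walks.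

Record rooting (V : eqType) (e : rel V) (depth : V -> nat) (parent : V -> V) :
    Prop := Rooting {
  parent_adj : forall x, 0 < depth x -> e x (parent x);
  depth_parent : forall x, 0 < depth x -> depth x = (depth (parent x)).+1;
  adj_parent : forall x y, e x y ->
    (0 < depth x /\ y = parent x) \/ (0 < depth y /\ x = parent y)
}.

Section DistanceToRoot.

Variables (V : eqType) (e : rel V) (r : V) (depth : V -> nat).
Hypotheses (symE : symmetric e) (irrE : irreflexive e).
Hypothesis acycE : acyclic_graph e.
Hypothesis depthP : forall x, at_distance e r x (depth x).

Lemma depth_eq0 x : depth x = 0 -> x = r.
Proof.
move=> depth_x; have [[s [_ ls]]] := depthP x.
by rewrite depth_x -ls => /size0nil ->.
Qed.

Lemma depth_adj_leq x y : e x y -> depth y <= (depth x).+1.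
Proof.
by move=> exy; apply: (depthP y).2; apply: walk_rcons exy; apply: (depthP x).1.
Qed.

Lemma ex_lower_neighbor x :
  0 < depth x -> exists2 y, e x y & depth x = (depth y).+1.
Proof.
case depth_x: (depth x) => [//|n] _; have [wx _] := depthP x.
rewrite depth_x in wx; have [y wy eyx] := walk_rcons_inv wx.
exists y; first by rewrite symE.
apply/eqP; rewrite -depth_x eqn_leq depth_adj_leq //.
by rewrite depth_x ltnS (depthP y).2.
Qed.

(* If the endpoints were different, prolong the path at both ends by lower
   neighbors: by induction these coincide, which closes a cycle. *)
Lemma path_above_closed x s : path e x s -> depth (last x s) = depth x ->
  all (fun z => depth x <= depth z) s -> last x s = x.
Proof.
move depth_x: (depth x) => n.
elim: n x s depth_x => [|n IH] x s depth_x ps depth_y above.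
  by rewrite (depth_eq0 depth_y) (depth_eq0 depth_x).
apply/eqP/negPn/negP => y_neq_x.
have [p exp depth_p] : exists2 p, e x p & n.+1 = (depth p).+1.
  by rewrite -depth_x; apply: ex_lower_neighbor; rewrite depth_x.
have [p' eyp' depth_p'] : exists2 p, e (last x s) p & n.+1 = (depth p).+1.
  by rewrite -depth_y; apply: ex_lower_neighbor; rewrite depth_y.
have p'_eq_p : p' = p.
  have := IH p (x :: rcons s p'); rewrite /= last_rcons; apply; first by lia.
  - by rewrite symE exp rcons_path ps.
  - by lia.
  - rewrite depth_x leqnSn all_rcons -ltnS -depth_p' leqnn /=.
    by apply: sub_all above => z; apply: ltnW.
subst p'; case: (shortenP ps) y_neq_x eyp'.
move=> s' ps' uniq_s' sub_s' y_neq_x eyp.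
have p_notin : p \notin x :: s'.
  rewrite inE negb_or; apply/andP; split.
    by apply/eqP => px; rewrite px depth_x in depth_p; lia.
  by apply/negP => /sub_s' /(allP above); lia.
have /acycE : ucycle e [:: p, x & s'].
  by rewrite /ucycle /cycle rcons_path /= symE exp ps' eyp p_notin.
by case: s' y_neq_x {ps' uniq_s' sub_s' eyp p_notin} => //=; rewrite eqxx.
Qed.

Lemma adj_depth_neq x y : e x y -> depth x <> depth y.
Proof.
move=> exy depth_xy; have := @path_above_closed x [:: y].
rewrite /= exy depth_xy leqnn => /(_ isT erefl isT) yx.
by move: exy; rewrite yx irrE.
Qed.

Lemma lower_neighbor_unique x y z : e x y -> e x z ->
  depth x = (depth y).+1 -> depth x = (depth z).+1 -> z = y.
Proof.
move=> exy exz depth_y depth_z; have := @path_above_closed y [:: x; z].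
by rewrite /= symE exy exz; apply; lia.
Qed.

Lemma depth_rooting : exists parent, rooting e depth parent.
Proof.
have /choice [parent parentP] :
    forall x, exists y, 0 < depth x -> e x y /\ depth x = (depth y).+1.
  move=> x; have [->|/ex_lower_neighbor [y]] := posnP (depth x).
    by exists x.
  by exists y.
have lower x y : e x y -> depth y < depth x -> 0 < depth x /\ y = parent x.
  move=> exy lt_yx; have x_gt0 : 0 < depth x by lia.
  split=> //; have [exp depth_p] := parentP _ x_gt0.
  apply: (lower_neighbor_unique exp exy depth_p).
  by apply/eqP; rewrite eqn_leq lt_yx andbT depth_adj_leq // symE.
exists parent; split=> [x /parentP[] // | x /parentP[] // | x y exy].
have [lt_xy|lt_yx|/(adj_depth_neq exy) //] := ltngtP (depth x) (depth y).
  by right; apply: lower; rewrite 1?symE.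
by left; apply: lower.
Qed.

End DistanceToRoot.

Lemma rooting_exists (V : eqType) (e : rel V) :
  simple_graph e -> connected_graph e -> acyclic_graph e ->
  exists depth parent, rooting e depth parent.
Proof.
move=> [symE irrE] connE acycE; have [[r] _] := connE.
have /choice [depth depthP] := connected_at_distance connE r.
by exists depth; apply: depth_rooting depthP.
Qed.

Section RootedDistance.

Variables (V : eqType) (e : rel V) (depth : V -> nat) (parent : V -> V).
Hypotheses (symE : symmetric e) (rootE : rooting e depth parent).

Lemma depth_iter_parent n x :
  n <= depth x -> depth (iter n parent x) = depth x - n.
Proof.
elim: n => [|n IH] lt_nx /=; first by rewrite subn0.
have depth_n := IH (ltnW lt_nx).
have := depth_parent rootE (x := iter n parent x); lia.
Qed.

Lemma walk_iter_parent n x : n <= depth x -> walk e x (iter n parent x) n.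
Proof.
elim: n => [|n IH] lt_nx; first by exists [::].
apply: walk_rcons (IH (ltnW lt_nx)) _; apply: (parent_adj rootE).
by rewrite depth_iter_parent ?subn_gt0 // ltnW.
Qed.

Definition common_ancestor (i j : nat) (x y : V) : Prop :=
  [/\ i <= depth x, j <= depth y & iter i parent x = iter j parent y].

Lemma common_ancestor_walk i j x y :
  common_ancestor i j x y -> walk e x y (i + j).
Proof.
move=> [i_leq j_leq eq_ij]; apply: walk_cat (walk_iter_parent i_leq) _.
by rewrite eq_ij; apply: walk_sym symE (walk_iter_parent j_leq).
Qed.

Lemma common_ancestor_depth i j x y :
  common_ancestor i j x y -> depth x + j = depth y + i.
Proof.
move=> [i_leq j_leq /(congr1 depth)]; rewrite !depth_iter_parent //; lia.
Qed.

Lemma walk_common_ancestor n x y :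
  walk e x y n -> exists i j, i + j <= n /\ common_ancestor i j x y.
Proof.
move=> [s [ps <- <-]]; elim: s x ps => [|z s IH] x /=; first by exists 0, 0.
case/andP=> /(adj_parent rootE) adj_xz /IH [i [j [leq_ij anc_zy]]].
have [i_leq j_leq eq_ij] := anc_zy.
case: adj_xz => [[x_gt0 zE]|[z_gt0 xE]].
  exists i.+1, j; split=> //; split=> //; last by rewrite iterSr -zE.
  by rewrite (depth_parent rootE x_gt0) -zE.
have depth_z : depth z = (depth x).+1 by rewrite xE (depth_parent rootE z_gt0).
case: i leq_ij anc_zy i_leq eq_ij => [|i] leq_ij anc_zy i_leq eq_ij.
  exists 0, j.+1; split=> //; split=> //=; last by rewrite -eq_ij.
  by have := common_ancestor_depth anc_zy; lia.
by exists i, j; split; [lia | split=> //; [lia | rewrite xE -iterSr]].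
Qed.

Lemma distance_common_ancestor d x y :
  at_distance e x y d -> exists i j, i + j = d /\ common_ancestor i j x y.
Proof.
move=> [/walk_common_ancestor [i [j [leq_ij anc_xy]]] min_d].
exists i, j; split=> //.
by apply/eqP; rewrite eqn_leq leq_ij min_d //; apply: common_ancestor_walk.
Qed.

End RootedDistance.

Definition degree_leq (V : eqType) (e : rel V) (n : nat) : Prop :=
  forall x, exists2 s : seq V, size s <= n & forall y, e x y -> y \in s.

Lemma regular_degree_leq (V : eqType) (e : rel V) n :
  regular_graph e n -> degree_leq e n.
Proof.
move=> regE x; have [s [_ size_s sE]] := regE x.
by exists s => [|y]; rewrite ?size_s // sE.
Qed.

Section RootedColoring.

Variables (V : eqType) (e : rel V) (depth : V -> nat) (parent : V -> V).
Hypotheses (symE : symmetric e) (rootE : rooting e depth parent).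
Variables (b : nat) (nbrs : V -> seq V).
Hypothesis size_nbrs : forall x, size (nbrs x) <= b.+1.
Hypothesis mem_nbrs : forall x y, e x y -> y \in nbrs x.

Definition children (x : V) : seq V := [seq y <- nbrs x | depth x < depth y].

Lemma mem_children x : 0 < depth x -> x \in children (parent x).
Proof.
move=> x_gt0; rewrite mem_filter -(depth_parent rootE x_gt0) leqnn /=.
by apply: mem_nbrs; rewrite symE; apply: parent_adj rootE _ x_gt0.
Qed.

Lemma size_children x : size (children x) + (0 < depth x) <= b.+1.
Proof.
apply: leq_trans (size_nbrs x).
rewrite size_filter -(count_predC (fun y => depth x < depth y)) leq_add2l.
case: posnP => // x_gt0; rewrite -has_count; apply/hasP; exists (parent x).
  by apply: mem_nbrs; apply: parent_adj rootE _ x_gt0.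
by rewrite /= (depth_parent rootE x_gt0) -leqNgt leqnSn.
Qed.

Definition sibling_rank (x : V) : nat := index x (children (parent x)).

Lemma sibling_rank_leq x : 0 < depth x -> sibling_rank x + (1 < depth x) <= b.
Proof.
move=> x_gt0; have := size_children (parent x).
have := mem_children x_gt0; rewrite -index_mem -/(sibling_rank x).
have := depth_parent rootE x_gt0; lia.
Qed.

Lemma sibling_rank_inj x y : 0 < depth x -> 0 < depth y ->
  parent x = parent y -> sibling_rank x = sibling_rank y -> x = y.
Proof.
move=> /mem_children x_in /mem_children y_in parent_xy.
by rewrite /sibling_rank parent_xy in x_in *; apply: index_inj.
Qed.

Variable k : nat.
Hypotheses (b_gt0 : 0 < b) (k_gt0 : 0 < k).

(* Any rank at most [b] would do at depths less than [k]: two vertices of the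
   same depth at distance [2k] have a common [k]-th ancestor. *)
Definition branch_rank (x : V) : nat :=
  if k <= depth x then sibling_rank (iter k.-1 parent x) else 0.

Lemma branch_rank_leq x : branch_rank x + (k < depth x) <= b.
Proof.
rewrite /branch_rank; case: (leqP k) => [k_leq|]; last by lia.
have depth_iter : depth (iter k.-1 parent x) = depth x - k.-1.
  by apply: (depth_iter_parent rootE); lia.
have := @sibling_rank_leq (iter k.-1 parent x); rewrite depth_iter; lia.
Qed.

Definition tree_color (x : V) : nat :=
  (depth x * b + branch_rank x) %% (b * k.*2.+1).

Lemma tree_color_distance x y :
  at_distance e x y k.*2 -> tree_color x <> tree_color y.
Proof.
move=> dist_xy color_xy.
have [i [j [ij_sum anc_xy]]] := distance_common_ancestor symE rootE dist_xy.
have depth_ij := common_ancestor_depth rootE anc_xy.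
have [depth_xy rank_xy] : depth x = depth y /\ branch_rank x = branch_rank y.
  apply: parity_digit_mod_inj b_gt0 k_gt0 _ _ _ _ _ color_xy;
    by [lia | apply: branch_rank_leq].
have [ik jk] : i = k /\ j = k by lia.
subst i j; have [k_leq_x k_leq_y iter_xy] := anc_xy.
have depth_iter z :
    k <= depth z -> depth (iter k.-1 parent z) = (depth z - k).+1.
  by move=> k_leq; rewrite (depth_iter_parent rootE); lia.
have lower_ancestor : common_ancestor depth parent k.-1 k.-1 x y.
  split; [lia | lia | apply: sibling_rank_inj].
  - by rewrite depth_iter.
  - by rewrite depth_iter.
  - by rewrite -!iterS prednK.
  - by move: rank_xy; rewrite /branch_rank k_leq_x k_leq_y.
by have := dist_xy.2 _ (common_ancestor_walk symE rootE lower_ancestor); lia.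
Qed.

Lemma rooted_distance_colorable : distance_colorable e k.*2 (b * k.*2.+1).
Proof.
have color_lt x : tree_color x < b * k.*2.+1 by rewrite ltn_mod muln_gt0 b_gt0.
exists (fun x => Ordinal (color_lt x)) => x y dist_xy /(congr1 val).
exact: tree_color_distance.
Qed.

End RootedColoring.

Lemma tree_distance_colorable (V : eqType) (e : rel V) b k :
    simple_graph e -> connected_graph e -> acyclic_graph e ->
    degree_leq e b.+1 -> 0 < b -> 0 < k ->
  distance_colorable e k.*2 (b * k.*2.+1).
Proof.
move=> simpleE connE acycE degE b_gt0 k_gt0.
have [depth [parent rootE]] := rooting_exists simpleE connE acycE.
have /choice [nbrs nbrsP] :
    forall x, exists s : seq V,
      size s <= b.+1 /\ forall y, e x y -> y \in s.
  by move=> x; have [s] := degE x; exists s.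
by apply: (rooted_distance_colorable simpleE.1 rootE (nbrs := nbrs)) => // x;
  have [] := nbrsP x.
Qed.

Theorem mainTheorem10 (q d : nat) (V : eqType) (e : rel V)
    (hq : 3 <= q) (hd : 0 < d) (hd_even : ~~ odd d)
    (hT : regular_tree e q) :
  exists k : nat,
    is_distance_chromatic_number e d k /\ k <= (q - 1) * (d + 1).
Proof.
have [simpleE connE acycE /regular_degree_leq degE] := hT.
apply: distance_chromatic_number_leq.
rewrite subn1 addn1 -(even_halfK hd_even).
apply: tree_distance_colorable => //; [|lia|lia].
by rewrite prednK //; lia.
Qed.
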